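(* Let $$R = \begin{pmatrix} 0 & 0 & -1\\ 1 & 0 & -1\\ 0 & 1 & -1 \end{pmatrix}, \qquad T = \begin{pmatrix} -1 & 0 & 0\\ 2 & 1 & 0\\ -4 & 0 & 1 \end{pmatrix},$$ and let $C = \mathrm{cone}(u,v,w)$ be the open cone in $\mathbb{R}^3$ generated by $u = (1,-2,1)$, $v = (1,0,3)$, $w = (0,-1,1)$. Let $C' = \mathrm{cone}(u',v',w')$ be the open cone generated by three linearly independent vectors $u',v',w' \in \mathbb{R}^3$, and define $$X = C' \cup -C', \qquad Y = RX \cup R^2X \cup R^3X.$$ If $X$ and $Y$ form a valid ping-pong table for $\langle R\rangle$ and $\langle T\rangle$, then $C' = C$ or $C' = -C$.
   Context: For $v_1,\dots,v_k\in\mathbb{R}^n$, the open cone generated by them is $\mathrm{cone}(v_1,\dots,v_k) = \{a_1v_1+\dots+a_kv_k \mid a_i \in \mathbb{R}_{>0}\}$. Matrices in $\mathrm{GL}_3(\mathbb{R})$ act on $\mathbb{R}^3$ (column vectors) by multiplication. One has $R^4=T^2=I$, so $\langle R\rangle = \{I,R,R^2,R^3\}$ and $\langle T\rangle=\{I,T\}$. Valid ping-pong table: if $G,H$ are non-trivial subgroups of a group $K$, at least one of which has more than two elements, and $K$ acts on a set $S$, then two non-empty subsets $X,Y\subset S$ form a valid ping-pong table for $G$ and $H$ if (1) $X\cap Y=\emptyset$; (2) $gx\in Y$ for all $g\in G\setminus\{1\}$ and $x\in X$; (3) $hy\in X$ for all $h\in H\setminus\{1\}$ and $y\in Y$. Here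 $K=\mathrm{GL}_3(\mathbb{R})$, $S=\mathbb{R}^3$, $G=\langle R\rangle$, $H=\langle T\rangle$. *)

(* Defs.v *)
From HB Require Import structures.
From mathcomp Require Import all_boot all_order all_algebra.
From mathcomp Require Import all_classical all_reals.
Set Implicit Arguments.
Unset Strict Implicit.
Unset Printing Implicit Defensive.
Import Order.TTheory GRing.Theory Num.Theory.
Local Open Scope classical_set_scope.
Local Open Scope ring_scope.

Section Defs.
Variable R : realType.

Definition col3 (a b c : R) : 'cV[R]_3 := \col_(i < 3) [:: a; b; c]`_i.

Definition matR : 'M[R]_3 :=
  \matrix_(i < 3, j < 3) (nth [::] [:: [:: 0; 0; -1];
                                       [:: 1; 0; -1];
                                       [:: 0; 1; -1]] i)`_j.

Definition matT : 'M[R]_3 :=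
  \matrix_(i < 3, j < 3) (nth [::] [:: [:: -1; 0; 0];
                                       [::  2; 1; 0];
                                       [:: -4; 0; 1]] i)`_j.

Definition cone n k (v : k.-tuple 'cV[R]_n) : set 'cV[R]_n :=
  [set x | exists2 a : 'I_k -> R,
             (forall i, 0 < a i) & x = \sum_(i < k) a i *: tnth v i].

Definition opp_set n (X : set 'cV[R]_n) : set 'cV[R]_n := [set - x | x in X].

Definition act_set n (A : 'M[R]_n) (X : set 'cV[R]_n) : set 'cV[R]_n :=
  [set A *m x | x in X].

(* A subgroup of GL_n(R) is represented by the set of its matrices. *)
Definition GL_subgroup n (G : set 'M[R]_n) : Prop :=
  [/\ forall g, G g -> g \in unitmx,
      G 1%:M,
      forall g h, G g -> G h -> G (g *m h) &
      forall g, G g -> G (invmx g)].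

(* Integer powers; negative ones are powers of the inverse matrix, so this is
   the subgroup generated by A as soon as A is invertible. *)
Definition cyclic_subgroup n (A : 'M[R]_n.+1) : set 'M[R]_n.+1 :=
  [set A ^ k | k in [set: int]].

Record valid_ping_pong n (G H : set 'M[R]_n) (X Y : set 'cV[R]_n) : Prop := {
  pp_subG : GL_subgroup G;
  pp_subH : GL_subgroup H;
  pp_ntG : G <> [set 1%:M];
  pp_ntH : H <> [set 1%:M];
  pp_card : (`I_3 #<= G)%card \/ (`I_3 #<= H)%card;
  pp_X0 : X !=set0;
  pp_Y0 : Y !=set0;
  pp_disj : X `&` Y = set0;
  pp_G : forall g x, G g -> g <> 1%:M -> X x -> Y (g *m x);
  pp_H : forall h y, H h -> h <> 1%:M -> Y y -> X (h *m y)
}.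

End Defs.

(* Main.v *)
Require Import Defs.
From HB Require Import structures.
From mathcomp Require Import all_boot all_order all_algebra.
From mathcomp Require Import all_classical all_reals.
From mathcomp Require Import ring lra.
Import Order.TTheory GRing.Theory Num.Theory.
Local Open Scope classical_set_scope.
Local Open Scope ring_scope.

(** The two elements TR and TR^3 = TR^-1 already determine the cone.

    Both R and R^3 send X into Y, which T sends back into X, so TR and TR^3
    preserve X.  Let U be one of them, B the matrix whose columns are the
    generators of C', and M = B^-1 U B.  Then M maps each vector of the open
    positive orthant into that orthant or into its opposite.  Consequently all
    entries of M have the same weak sign ([mx_definite_cone_sign]).

    Both TR and TR^3 are unipotent, with traces of the first three powers equal
    to 3.  The trace of M makes M nonnegative, and a nonnegative matrix with
    these traces has only 1s on its diagonal and no cycle of positive entries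
    off it, so that it is triangular after a permutation of the basis
    ([nonneg_unipotent_flag]).  Hence some generator of C' is fixed by U, and a
    second one is fixed modulo the first ([unipotent_cone_flag]).

    Now TR is a single Jordan block, with fixed line spanned by u and with the
    plane x + y + z = 0 as kernel of (TR - 1)^2.  For TR^3 the fixed line is
    spanned by v and the plane is -3x + y + z = 0.  As v is not in the first
    plane and u not in the second one, the generators of C' are multiples of u,
    of v, and of a vector common to both planes, that is, of w.

    It remains to compare the signs of the three factors.  The matrix TR maps
    the generator proportional to v to a nonnegative combination of the
    generators, and TR v = 2u + v + 4w; so the factors of u and of w have the
    sign of the factor of v.  According to that common sign, C' is C or -C.

    Geometrically, T and R generate a lattice acting on a hyperbolic plane whose
    boundary conic passes through the cusps u and v of TR and TR^3; the two
    planes are the tangents to the conic at u and v, and w is where they meet.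
*)

(** * Sums and case analysis over three indices *)

Lemma ord3_ind (P : 'I_3 -> Prop) : P 0 -> P 1 -> P 2 -> forall i, P i.
Proof.
move=> P0 P1 P2 [[|[|[|//]]] lti].
- by rewrite (_ : Ordinal lti = 0) //; apply: val_inj.
- by rewrite (_ : Ordinal lti = 1) //; apply: val_inj.
- by rewrite (_ : Ordinal lti = 2) //; apply: val_inj.
Qed.

Lemma sum_ord3 (V : nmodType) (F : 'I_3 -> V) :
  \sum_(i < 3) F i = F 0 + F 1 + F 2.
Proof.
rewrite !big_ord_recl big_ord0 addr0 addrA.
by congr (_ + F _ + F _); apply: val_inj.
Qed.

(** * Nonnegative unipotent matrices *)

Section NonnegativeMatrices.
Variable R : realFieldType.

(** Let e be the all-ones vector.  If an entry M i j had the sign opposite to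
    (M e)_i, moving from e in the j-th direction would stay in the open orthant
    and bring the i-th coordinate of the image down to zero. *)
Lemma mx_definite_cone_sign n (M : 'M[R]_n) :
  (forall a : 'cV[R]_n, (forall i, 0 < a i 0) ->
     (forall i, 0 < (M *m a) i 0) \/ (forall i, (M *m a) i 0 < 0)) ->
  (forall i j, 0 <= M i j) \/ (forall i j, M i j <= 0).
Proof.
move=> Mdef; pose e : 'cV[R]_n := const_mx 1.
have opp_sign i j : (M *m e) i 0 * M i j < 0 -> False.
  move=> SM_lt0.
  have Mn0 : M i j != 0 by apply: contraTneq SM_lt0 => ->; rewrite mulr0 ltxx.
  pose t := - ((M *m e) i 0 / M i j).
  have t_gt0 : 0 < t.
    rewrite oppr_gt0 -(pmulr_llt0 (x := M i j ^+ 2)); last first.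
      by rewrite exprn_even_gt0.
    by rewrite expr2 mulrA mulfVK.
  have zero : (M *m (e + t *: delta_mx j 0)) i 0 = 0.
    rewrite mulmxDr -scalemxAr -colE !mxE /t mulNr mulfVK //.
    by rewrite mxE subrr.
  have [|/(_ i)|/(_ i)] := Mdef (e + t *: delta_mx j 0).
  - by move=> k; rewrite !mxE ltr_pwDl // mulr_ge0 // ltW.
  - by rewrite zero ltxx.
  - by rewrite zero ltxx.
have [|e_gt0|e_lt0] := Mdef e; first by move=> i; rewrite mxE.
- left=> i j; rewrite leNgt; apply/negP => M_lt0.
  by apply: (opp_sign i j); rewrite pmulr_rlt0.
- right=> i j; rewrite leNgt; apply/negP => M_gt0.
  by apply: (opp_sign i j); rewrite pmulr_llt0.
Qed.

(* Tries the six ordered pairs of distinct indices in a lemma [flag] that takes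
   such a pair. *)
Ltac find_flag flag := first [by apply: (flag 0 1) | by apply: (flag 0 2)
  | by apply: (flag 1 0) | by apply: (flag 1 2)
  | by apply: (flag 2 0) | by apply: (flag 2 1)].

(** The traces of M and M^2 express the sum of all (M i i - 1)^2 and of all
    products M i j * M j i with i != j as 0; these terms being nonnegative, they
    all vanish.  The trace of M^3 then kills the two products along 3-cycles.
    The positive off-diagonal entries thus form an acyclic graph, and any
    compatible ordering of the indices starts with suitable i and j. *)
Lemma nonneg_unipotent_flag (M : 'M[R]_3) :
  (forall i j, 0 <= M i j) ->
  \tr M = 3 -> \tr (M *m M) = 3 -> \tr (M *m M *m M) = 3 ->
  exists i, exists2 j, i != j &
    (forall k, M k i = (k == i)%:R) /\
    (forall k, k != i -> M k j = (k == j)%:R).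
Proof.
move=> M_ge0; rewrite /mxtrace !sum_ord3 !mxE !sum_ord3 !mxE !sum_ord3.
move: (M_ge0 0 0) (M_ge0 0 1) (M_ge0 0 2) (M_ge0 1 0) (M_ge0 1 1) (M_ge0 1 2)
  (M_ge0 2 0) (M_ge0 2 1) (M_ge0 2 2).
move Ea : (M 0 0) => a; move Eb : (M 0 1) => b; move Ec : (M 0 2) => c.
move Ed : (M 1 0) => d; move Ee : (M 1 1) => e; move Ef : (M 1 2) => f.
move Eg : (M 2 0) => g; move Eh : (M 2 1) => h; move Ek : (M 2 2) => k.
move=> a0 b0 c0 d0 e0 f0 g0 h0 k0 tr1 tr2 tr3.
have bd0 : 0 <= b * d by rewrite mulr_ge0.
have cg0 : 0 <= c * g by rewrite mulr_ge0.
have fh0 : 0 <= f * h by rewrite mulr_ge0.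
have sq : (a - 1) ^+ 2 + (e - 1) ^+ 2 + (k - 1) ^+ 2
   + 2 * (b * d) + 2 * (c * g) + 2 * (f * h) = 0.
  transitivity (3 - 2 * 3 + 3 : R); last by ring.
  by rewrite -{1}tr2 -{1}tr1; ring.
have [[a1 e1] k1] := (sqr_ge0 (a - 1), sqr_ge0 (e - 1), sqr_ge0 (k - 1)).
have /eqP : (a - 1) ^+ 2 = 0 by lra.
have /eqP : (e - 1) ^+ 2 = 0 by lra.
have /eqP : (k - 1) ^+ 2 = 0 by lra.
rewrite !sqrf_eq0 !subr_eq0 => /eqP k_1 /eqP e_1 /eqP a_1.
have bd : b * d = 0 by lra.
have cg : c * g = 0 by lra.
have fh : f * h = 0 by lra.
move: Ea Ee Ek tr3; rewrite a_1 e_1 k_1 => Ea Ee Ek tr3.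
have bfg0 : 0 <= b * f * g by rewrite !mulr_ge0.
have chd0 : 0 <= c * h * d by rewrite !mulr_ge0.
have cycles : 3 * (b * f * g) + 3 * (c * h * d) = 0.
  transitivity (3 - 3 - 6 * (b * d + c * g + f * h)); last first.
    by rewrite bd cg fh; ring.
  rewrite -[X in X - 3 - _]tr3; ring.
have bfg : b * f * g = 0 by lra.
have chd : c * h * d = 0 by lra.
have flag (i j : 'I_3) : i != j ->
  [/\ M 0 i = (0 == i)%:R, M 1 i = (1 == i)%:R & M 2 i = (2 == i)%:R] ->
  [/\ 0 != i -> M 0 j = (0 == j)%:R, 1 != i -> M 1 j = (1 == j)%:R
    & 2 != i -> M 2 j = (2 == j)%:R] ->
  exists i, exists2 j, i != j &
    (forall k, M k i = (k == i)%:R) /\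
    (forall k, k != i -> M k j = (k == j)%:R).
  move=> ij [? ? ?] [? ? ?]; exists i, j => //.
  by split; elim/ord3_ind.
have bd' : (b == 0) || (d == 0) by rewrite -mulf_eq0 bd.
have cg' : (c == 0) || (g == 0) by rewrite -mulf_eq0 cg.
have fh' : (f == 0) || (h == 0) by rewrite -mulf_eq0 fh.
have bfg' : [|| b == 0, f == 0 | g == 0] by rewrite orbA -!mulf_eq0 bfg.
have chd' : [|| c == 0, h == 0 | d == 0] by rewrite orbA -!mulf_eq0 chd.
case/orP: bd' => /eqP x1; case/orP: cg' => /eqP x2;
  case/orP: fh' => /eqP x3; subst.
(* The vanishing entries orient the three edges; only the two cyclic
   orientations survive this step. *)
all: try find_flag flag.
- by case/or3P: chd' => /eqP x4; find_flag flag.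
- by case/or3P: bfg' => /eqP x4; find_flag flag.
Qed.
End NonnegativeMatrices.

(** * Simplicial cones invariant under a unipotent matrix *)

Section Cones.
Set Implicit Arguments.
Unset Strict Implicit.
Variable R : realType.

Lemma cone_rescale n k (v w : k.-tuple 'cV[R]_n) (s : 'I_k -> 'I_k)
    (c : 'I_k -> R) :
  injective s -> (forall i, 0 < c i) ->
  (forall i, tnth v (s i) = c i *: tnth w i) -> cone v = cone w.
Proof.
move=> s_inj c_gt0 vE; have [s' sK s'K] := injF_bij s_inj.
have reindex_cone a :
    \sum_i a i *: tnth v i = \sum_i (a (s i) * c i) *: tnth w i.
  rewrite (reindex_inj s_inj); apply: eq_bigr => i _.
  by rewrite vE scalerA.
apply/seteqP; split=> x /= [a a_gt0 ->].
  by exists (fun i => a (s i) * c i); rewrite // => i; rewrite mulr_gt0.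
exists (fun i => a (s' i) / c (s' i)) => [i|]; first by rewrite divr_gt0.
rewrite reindex_cone; apply: eq_bigr => i _.
by rewrite sK divfK // gt_eqF.
Qed.

Lemma opp_set_cone n k (v : k.-tuple 'cV[R]_n) :
  opp_set (cone v) = cone [tuple - tnth v i | i < k].
Proof.
have sumN a : \sum_i a i *: tnth [tuple - tnth v i | i < k] i
    = - \sum_i a i *: tnth v i.
  by rewrite -sumrN; apply: eq_bigr => i _; rewrite tnth_mktuple scalerN.
apply/seteqP; split=> [x [_ [a a_gt0 ->] <-]|x [a a_gt0 ->]].
  by exists a.
by rewrite sumN; exists (\sum_i a i *: tnth v i) => //; exists a.
Qed.

Definition gen_mx n k (v : k.-tuple 'cV[R]_n) : 'M[R]_(n, k) :=
  \matrix_(i, j) tnth v j i 0.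

Lemma col_gen_mx n k (v : k.-tuple 'cV[R]_n) j : col j (gen_mx v) = tnth v j.
Proof. by apply/colP=> i; rewrite !mxE. Qed.

Lemma gen_mxE n k (v : k.-tuple 'cV[R]_n) (a : 'cV[R]_k) :
  gen_mx v *m a = \sum_j a j 0 *: tnth v j.
Proof.
apply/colP=> i; rewrite !mxE summxE; apply: eq_bigr => j _.
by rewrite !mxE mulrC.
Qed.

Lemma cone_gen_mx n k (v : k.-tuple 'cV[R]_n) x :
  cone v x <-> exists2 a : 'cV[R]_k, (forall j, 0 < a j 0) & x = gen_mx v *m a.
Proof.
split=> -[a a_gt0 ->].
  exists (\col_j a j) => [j|]; first by rewrite mxE.
  by rewrite gen_mxE; apply: eq_bigr => j _; rewrite mxE.
by exists (fun j => a j 0) => //; rewrite gen_mxE.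
Qed.

Lemma gen_mx_unit n (v : n.-tuple 'cV[R]_n) : free v -> gen_mx v \in unitmx.
Proof.
move=> /freeP v_free; rewrite -unitmx_tr -row_free_unit.
apply: inj_row_free => a a0; apply/rowP => j; rewrite mxE.
apply: (v_free (fun j => a 0 j)).
transitivity (gen_mx v *m a^T); last first.
  by apply: trmx_inj; rewrite trmx_mul trmxK a0 trmx0.
by rewrite gen_mxE; apply: eq_bigr => i _; rewrite mxE (tnth_nth 0).
Qed.

(** The matrix of U in the basis v is nonnegative: its sign is constant because
    U preserves the double cone, and the trace 3 rules out the negative sign.
    The first conclusion is this nonnegativity; the second one reads the flag of
    [nonneg_unipotent_flag] as a statement on the generators. *)
Lemma unipotent_cone_flag (v : 3.-tuple 'cV[R]_3) (U : 'M[R]_3) :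
  free v ->
  (forall x, (cone v `|` opp_set (cone v)) x ->
     (cone v `|` opp_set (cone v)) (U *m x)) ->
  \tr U = 3 -> \tr (U *m U) = 3 -> \tr (U *m U *m U) = 3 ->
  (forall i, exists2 m : 'I_3 -> R, (forall k, 0 <= m k) &
     U *m tnth v i = \sum_k m k *: tnth v k) /\
  exists i, exists2 j, i != j &
    U *m tnth v i = tnth v i /\
    exists m, U *m tnth v j = tnth v j + m *: tnth v i.
Proof.
move=> v_free UX tr1 tr2 tr3.
set B := gen_mx v; have Bu : B \in unitmx by apply: gen_mx_unit.
pose M := invmx B *m U *m B.
have BM (a : 'cV_3) : B *m (M *m a) = U *m (B *m a).
  by rewrite /M !mulmxA mulmxV // mul1mx.
have trM (V : 'M_3) : \tr (invmx B *m V *m B) = \tr V.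
  by rewrite mxtrace_mulC mulmxA mulmxV // mul1mx.
have MM : M *m M = invmx B *m (U *m U) *m B.
  by rewrite /M !mulmxA mulmxK.
have MMM : M *m M *m M = invmx B *m (U *m U *m U) *m B.
  by rewrite MM /M !mulmxA mulmxK.
have [M_ge0|M_le0] : (forall i j, 0 <= M i j) \/ (forall i j, M i j <= 0).
- apply: mx_definite_cone_sign => a a_gt0.
  have : (cone v `|` opp_set (cone v)) (B *m (M *m a)).
    by rewrite BM; apply: UX; left; apply/cone_gen_mx; exists a.
  have Binj := can_inj (mulKmx Bu).
  move=> [/cone_gen_mx|[x /cone_gen_mx]] [b b_gt0].
    by move=> /Binj ->; left.
  move=> ->; rewrite -mulmxN => /Binj <-; right=> i.
  by rewrite mxE oppr_lt0.
- have [|||i [j ij [Mi Mj]]] := @nonneg_unipotent_flag _ M M_ge0.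
  + by rewrite trM.
  + by rewrite MM trM.
  + by rewrite MMM trM.
  have UvE l : U *m tnth v l = \sum_k M k l *: tnth v k.
    rewrite -col_gen_mx -/B colE -BM gen_mxE; apply: eq_bigr => k _.
    by rewrite -colE mxE.
  split=> [l|]; first by exists (fun k => M k l).
  exists i, j => //; rewrite !UvE; split.
    rewrite (bigD1 i) //= Mi eqxx scale1r big1 ?addr0 // => k /negPf ki.
    by rewrite Mi ki scale0r.
  exists (M i j); rewrite (bigD1 i) //= addrC (bigD1 j) /= 1?eq_sym //.
  rewrite Mj 1?eq_sym // eqxx scale1r big1 ?addr0 // => k /andP[ki /negPf kj].
  by rewrite Mj // kj scale0r.
- suff : \tr M <= 0 by rewrite trM tr1; lra.
  by apply: sumr_le0 => i _.
Qed.
End Cones.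

(** * The fixed lines and invariant planes of TR and TR^3 *)

Section Hypergeometric.
Set Implicit Arguments.
Unset Strict Implicit.
Variable R : realType.
Implicit Types (x y z : R) (b : 'cV[R]_3).

Lemma col3_eta b : b = col3 (b 0 0) (b 1 0) (b 2 0).
Proof. by apply/colP; elim/ord3_ind; rewrite mxE. Qed.

Lemma col3_inj x y z x' y' z' :
  col3 x y z = col3 x' y' z' -> [/\ x = x', y = y' & z = z'].
Proof.
move=> /colP e; move: (e 0) (e 1) (e 2).
by rewrite !mxE.
Qed.

Lemma scale_col3 c x y z : c *: col3 x y z = col3 (c * x) (c * y) (c * z).
Proof. by apply/colP; elim/ord3_ind; rewrite !mxE. Qed.

Lemma add_col3 x y z x' y' z' :
  col3 x y z + col3 x' y' z' = col3 (x + x') (y + y') (z + z').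
Proof. by apply/colP; elim/ord3_ind; rewrite !mxE. Qed.

(** Reduces a trace to three images of basis vectors, so that the traces of
    powers follow from the action on columns alone. *)
Lemma mxtrace_col3 (A : 'M[R]_3) :
  \tr A = (A *m col3 1 0 0) 0 0 + (A *m col3 0 1 0) 1 0 + (A *m col3 0 0 1) 2 0.
Proof.
by rewrite /mxtrace !mxE !sum_ord3 !mxE /= !(mulr0, mulr1, addr0, add0r).
Qed.

Lemma matR_col3 x y z : matR R *m col3 x y z = col3 (- z) (x - z) (y - z).
Proof.
by apply/colP; elim/ord3_ind; rewrite !mxE sum_ord3 !mxE /=; ring.
Qed.

Lemma matT_col3 x y z :
  matT R *m col3 x y z = col3 (- x) (2 * x + y) (- 4 * x + z).
Proof.
by apply/colP; elim/ord3_ind; rewrite !mxE sum_ord3 !mxE /=; ring.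
Qed.

Lemma TR_col3 x y z :
  matT R *m matR R *m col3 x y z = col3 z (x - 3 * z) (y + 3 * z).
Proof.
by rewrite -mulmxA matR_col3 matT_col3; congr col3; ring.
Qed.

Lemma TR3_col3 x y z :
  matT R *m matR R ^+ 3 *m col3 x y z
  = col3 (x - y) (- 3 * x + 2 * y + z) (3 * x - 4 * y).
Proof.
rewrite !exprS expr0 mulr1 -!mulmxE -!mulmxA !matR_col3 matT_col3.
by congr col3; ring.
Qed.

Lemma TR_fixed b : matT R *m matR R *m b = b -> b = b 0 0 *: col3 1 (-2) 1.
Proof.
rewrite {1 2}[b]col3_eta TR_col3 => /col3_inj[xz yz _].
by rewrite {1}[b]col3_eta scale_col3; congr col3; lra.
Qed.

Lemma TR3_fixed b : matT R *m matR R ^+ 3 *m b = b -> b = b 0 0 *: col3 1 0 3.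
Proof.
rewrite {1 2}[b]col3_eta TR3_col3 => /col3_inj[xy _ z].
by rewrite {1}[b]col3_eta scale_col3; congr col3; lra.
Qed.

(** The equation obtained is that of the kernel of (TR - 1)^2, as the right-hand
    vector spans the fixed line of TR. *)
Lemma TR_plane b m : matT R *m matR R *m b = b + m *: col3 1 (-2) 1 ->
  b 0 0 + b 1 0 + b 2 0 = 0.
Proof.
rewrite {1 2}[b]col3_eta TR_col3 scale_col3 add_col3 => /col3_inj[e1 e2 e3].
by lra.
Qed.

Lemma TR3_plane b m : matT R *m matR R ^+ 3 *m b = b + m *: col3 1 0 3 ->
  - 3 * b 0 0 + b 1 0 + b 2 0 = 0.
Proof.
rewrite {1 2}[b]col3_eta TR3_col3 scale_col3 add_col3 => /col3_inj[e1 e2 e3].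
by lra.
Qed.

Lemma TR_traces (U := matT R *m matR R) :
  [/\ \tr U = 3, \tr (U *m U) = 3 & \tr (U *m U *m U) = 3].
Proof.
split; rewrite mxtrace_col3 -?(mulmxA _ U) !TR_col3 !mxE /=; ring.
Qed.

Lemma TR3_traces (U := matT R *m matR R ^+ 3) :
  [/\ \tr U = 3, \tr (U *m U) = 3 & \tr (U *m U *m U) = 3].
Proof.
split; rewrite mxtrace_col3 -?(mulmxA _ U) !TR3_col3 !mxE /=; ring.
Qed.

End Hypergeometric.

(** * Uniqueness of the cone *)

Theorem theorem3p1 (R : realType) (u' v' w' : 'cV[R]_3) :
  let C := cone [tuple col3 1 (-2) 1; col3 1 0 3; col3 0 (-1) 1] in
  let C' := cone [tuple u'; v'; w'] in
  let X := C' `|` opp_set C' in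
  let Y := act_set (matR R) X `|` act_set (matR R ^+ 2) X
             `|` act_set (matR R ^+ 3) X in
  free [:: u'; v'; w'] ->
  valid_ping_pong (cyclic_subgroup (matR R)) (cyclic_subgroup (matT R)) X Y ->
  C' = C \/ C' = opp_set C.
Proof.
move=> C C' X Y v_free pp.
set g := [tuple u'; v'; w'].
have TY y : Y y -> X (matT R *m y).
  apply: pp_H pp _ _ _ _; first by exists 1.
  (* The top left entry of T is -1. *)
  move=> /matrixP/(_ 0 0); rewrite !mxE /= => e; lra.
have TRX x : X x -> X (matT R *m matR R *m x).
  by move=> Xx; rewrite -mulmxA; apply: TY; left; left; exists x.
have TR3X x : X x -> X (matT R *m matR R ^+ 3 *m x).
  by move=> Xx; rewrite -mulmxA; apply: TY; right; exists x.
have [t1 t2 t3] := TR_traces R.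
have [TRg [i [j ij [/TR_fixed gi [m gj]]]]] :=
  unipotent_cone_flag v_free TRX t1 t2 t3.
have [t1' t2' t3'] := TR3_traces R.
have [_ [i' [j' ij' [/TR3_fixed gi' [m' gj']]]]] :=
  unipotent_cone_flag v_free TR3X t1' t2' t3'.
have g_neq0 k : tnth g k != 0 by apply: free_not0 v_free (mem_tnth k g).
rewrite -/g in gi gi' gj gj' TRg.
move: (g_neq0 i) (g_neq0 i') gi gi'.
set al := tnth g i 0 0; set be := tnth g i' 0 0 => gi0 gi'0 gi gi'.
have al0 : al != 0 by apply: contraNneq gi0; rewrite gi => ->; rewrite scale0r.
have be0 : be != 0 by apply: contraNneq gi'0; rewrite gi' => ->;
  rewrite scale0r.
move: gj gj'; rewrite gi gi' !scalerA => /TR_plane gj /TR3_plane gj'.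
(* As u is not a multiple of v and lies off the plane of TR^3, and v lies off
   that of TR, the indices i, i', j are distinct and j' = j. *)
have ii' : i != i'.
  apply: contra_neq be0 => e; move: gi'; rewrite -e gi !scale_col3.
  by case/col3_inj => *; lra.
have ji' : j != i'.
  apply: contra_neq be0 => e; move: gj; rewrite e gi' !mxE /=; lra.
have j'i : j' != i.
  apply: contra_neq al0 => e; move: gj'; rewrite e gi !mxE /=; lra.
have ej : j' = j.
  move: i i' j j' ij ij' ii' ji' j'i {gi gi' gj gj' gi0 gi'0 al be al0 be0}.
  by do 4 (elim/ord3_ind => //).
rewrite {j' ij' j'i}ej in gj'.
(* The third generator lies in both planes, which meet along w. *)
set ga := tnth g j 2 0 in gj gj'.
have gjE : tnth g j = ga *: col3 0 (-1) 1.
  by rewrite [tnth g j]col3_eta scale_col3; congr col3; rewrite -/ga; lra.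
pose s := tnth [tuple i; i'; j].
have s_inj : injective s.
  by apply/tuple_uniqP; rewrite /= !inE !negb_or ii' ij eq_sym ji'.
(* TR v = 2u + v + 4w, hence the constants 2 and 4 below. *)
have [n n_ge0] := TRg i'.
rewrite (reindex_inj s_inj) sum_ord3 /= gi gi' gjE !scale_col3.
rewrite !add_col3 TR_col3 => /col3_inj[e1 e2 e3].
have al_be : n i * al = 2 * be by lra.
have ga_be : n j * ga = 4 * be by lra.
pose c := tnth [tuple al; be; ga].
have gs k : tnth g (s k)
    = c k *: tnth [tuple col3 1 (-2) 1; col3 1 0 3; col3 0 (-1) 1] k.
  by elim/ord3_ind: k.
have sign_of (p q : R) : 0 <= p -> 0 < p * q -> 0 < q.
  move=> p_ge0 pq_gt0; rewrite ltNge; apply/negP => q_le0.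
  by have := mulr_ge0_le0 p_ge0 q_le0; rewrite leNgt pq_gt0.
have [be_gt0|be_lt0] : 0 < be \/ be < 0 by case: (ltgtP be 0) be0 => //; auto.
- left; apply: (cone_rescale s_inj _ gs); elim/ord3_ind => //=.
  + by apply: (sign_of (n i)) => //; rewrite al_be mulr_gt0.
  + by apply: (sign_of (n j)) => //; rewrite ga_be mulr_gt0.
- right; rewrite opp_set_cone.
  apply: (cone_rescale (c := fun k => - c k) s_inj) => [|k]; last first.
    by rewrite gs tnth_mktuple scalerN scaleNr opprK.
  elim/ord3_ind => /=.
  + by apply: (sign_of (n i)) => //; rewrite mulrN al_be; lra.
  + by rewrite oppr_gt0.
  + by apply: (sign_of (n j)) => //; rewrite mulrN ga_be; lra.
Qed.
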